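(* Let $k$ be a field with $\operatorname{char} k\neq 2$, let $\beta,\delta\in k$, and let $L$ be a Lie algebra over $k$ with a basis $\{e_1,e_2,e_3\}$ such that $$[e_1,e_2]=0,\quad [e_1,e_3]=e_1+\beta e_2,\quad [e_2,e_3]=\delta e_2 .$$ Let $r\in L\otimes L$. (I) If $r$ is strongly symmetric, then $r$ is a solution of the CYBE. (II) If $\beta=0$ and $\delta\neq 0$, then $r$ is a solution of the CYBE in $L$ if and only if $r$ is strongly symmetric, or there are $p,q,s,u,x,y\in k$ with $$xu=xs=ys=yu=(1-\delta)us=(1+\delta)s(q+p)=(1+\delta)u(q+p)=0$$ such that $$r=p(e_1\otimes e_2)+q(e_2\otimes e_1)+s(e_1\otimes e_3)-s(e_3\otimes e_1)+u(e_2\otimes e_3)-u(e_3\otimes e_2)+x(e_1\otimes e_1)+y(e_2\otimes e_2).$$ (III) If $\beta\neq 0$ and $\delta=1$, then $r$ is a solution of the CYBE in $L$ if and only if $r$ is strongly symmetric, or there are $p,q,u,x,y\in k$ with $xu=yu=u(q+p)=0$ such that $$r=p(e_1\otimes e_2)+q(e_2\otimes e_1)+u(e_2\otimes e_3)-u(e_3\otimes e_2)+x(e_1\otimes e_1)+y(e_2\otimes e_2).$$ (IV) If $\beta=\delta=0$, then $r$ is a solution of the CYBE in $L$ if and only if one of the following holds: (a) there are $p,q,s,u,v,x,y,z\in k$ with $z\neq 0$, $zp=vs$, $zq=us$, $zx=s^2$ such that $$r=p(e_1\otimes e_2)+q(e_2\otimes e_1)+s(e_1\otimes e_3)+s(e_3\otimes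 e_1)+u(e_2\otimes e_3)+v(e_3\otimes e_2)+x(e_1\otimes e_1)+y(e_2\otimes e_2)+z(e_3\otimes e_3);$$ (b) there are $p,q,s,u,v,x,y\in k$ with $us=vs=xs=xu=xv=0$, $up=qv$, $s(p+q)=0$ such that $$r=p(e_1\otimes e_2)+q(e_2\otimes e_1)+s(e_1\otimes e_3)-s(e_3\otimes e_1)+u(e_2\otimes e_3)+v(e_3\otimes e_2)+x(e_1\otimes e_1)+y(e_2\otimes e_2).$$
   Context: For a Lie algebra $L$ over $k$ and $r=\sum_i a_i\otimes b_i\in L\otimes L$, define in $L\otimes L\otimes L$: $[r^{12},r^{13}]=\sum_{i,j}[a_i,a_j]\otimes b_i\otimes b_j$, $[r^{12},r^{23}]=\sum_{i,j}a_i\otimes[b_i,a_j]\otimes b_j$, $[r^{13},r^{23}]=\sum_{i,j}a_i\otimes a_j\otimes[b_i,b_j]$. The element $r$ is a solution of the classical Yang–Baxter equation (CYBE) in $L$ if $[r^{12},r^{13}]+[r^{12},r^{23}]+[r^{13},r^{23}]=0$. Writing $r=\sum_{i,j=1}^3k_{ij}(e_i\otimes e_j)$ with $k_{ij}\in k$, $r$ is strongly symmetric (to the basis $\{e_1,e_2,e_3\}$) if $k_{ij}=k_{ji}$ and $k_{ij}k_{lm}=k_{il}k_{jm}$ for all $i,j,l,m\in\{1,2,3\}$; this is independent of the basis. *)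

(* Defs.v *)
From HB Require Import structures.
From mathcomp Require Import all_boot all_order all_algebra.

Set Implicit Arguments.
Unset Strict Implicit.
Unset Printing Implicit Defensive.

Import GRing.Theory.
Local Open Scope ring_scope.

HB.mixin Record isLieAlgebra (k : fieldType) L of Vector k L := {
  lie : L -> L -> L;
  lie_linearl : forall y, linear (fun x => lie x y);
  lie_linearr : forall x, linear (lie x);
  lie_alternating : forall x, lie x x = 0;
  lie_jacobi : forall x y z,
    lie x (lie y z) + lie y (lie z x) + lie z (lie x y) = 0
}.

(* The underlying vector space is a vectType, so these Lie algebras are
   finite-dimensional. *)
#[short(type="fdLieAlgType")]
HB.structure Definition FdLieAlgebra (k : fieldType) :=
  {L of Vector k L & isLieAlgebra k L}.

(* V ⊗ W for finite-dimensional V and W: an element is the matrix of its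
   coordinates in the family b_i ⊗ c_j, where b and c are the library's bases
   of V and W. The lemmas tlift_tprod and tens_linear_ext below show that this
   is a tensor product: every bilinear map on V x W factors uniquely through
   tprod. *)
Definition tens (k : fieldType) (V W : vectType k) : Type :=
  'M[k]_(\dim {:V}, \dim {:W}).

HB.instance Definition _ (k : fieldType) (V W : vectType k) :=
  Vector.on (tens V W).

Definition tprod (k : fieldType) (V W : vectType k) (v : V) (w : W)
    : tens V W :=
  \matrix_(i, j) (coord (vbasis {:V}) i v * coord (vbasis {:W}) j w).

Notation "v ⊗ w" := (tprod v w) (at level 38, right associativity)
  : ring_scope.

(* The linear map on V ⊗ W induced by a bilinear f. *)
Definition tlift (k : fieldType) (V W : vectType k) (U : lmodType k)
    (f : V -> W -> U) (t : tens V W) : U :=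
  \sum_i \sum_j (t : 'M_(_, _)) i j *: f (vbasis {:V})`_i (vbasis {:W})`_j.

Section TensorProduct.
Variables (k : fieldType) (V W : vectType k).

Lemma tprod_linearl (w : W) : linear (fun v : V => v ⊗ w).
Proof. by move=> a u v; apply/matrixP=> i j; rewrite !mxE linearP mulrDl mulrA. Qed.

Lemma tprod_linearr (v : V) : linear (fun w : W => v ⊗ w).
Proof. by move=> a u w; apply/matrixP=> i j; rewrite !mxE linearP mulrDr mulrCA. Qed.

Lemma tprod_basis (i : 'I_(\dim {:V})) (j : 'I_(\dim {:W})) :
  (vbasis {:V})`_i ⊗ (vbasis {:W})`_j = (delta_mx i j : 'M[k]_(_, _)).
Proof.
apply/matrixP=> i' j'; rewrite !mxE !coord_free ?(basis_free (vbasisP _)) //.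
by rewrite -natrM mulnb (eq_sym i') (eq_sym j').
Qed.

Lemma tlift_linear (U : lmodType k) (f : V -> W -> U) : linear (tlift f).
Proof.
move=> a s t; rewrite /tlift scaler_sumr -big_split; apply: eq_bigr => i _.
rewrite scaler_sumr -big_split; apply: eq_bigr => j _.
by rewrite !mxE scalerDl scalerA.
Qed.

Lemma tlift_tprod (U : lmodType k) (f : V -> W -> U) :
  (forall w, linear (f^~ w)) -> (forall v, linear (f v)) ->
  forall v w, tlift f (v ⊗ w) = f v w.
Proof.
move=> fl fr v w.
pose gl w := GRing.isLinear.Build k V U _ (f^~ w) (fl w).
pose gr v := GRing.isLinear.Build k W U _ (f v) (fr v).
pose Fl w : {linear V -> U} := HB.pack (f^~ w) (gl w).
pose Fr v : {linear W -> U} := HB.pack (f v) (gr v).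
have -> : f v w = Fl w v by [].
rewrite [in RHS](coord_vbasis (memvf v)) linear_sum; apply: eq_bigr => i _.
rewrite linearZ /= -[f _ w]/(Fr _ w) [in RHS](coord_vbasis (memvf w)).
rewrite linear_sum scaler_sumr; apply: eq_bigr => j _.
by rewrite linearZ /= scalerA mxE.
Qed.

Lemma tens_linear_ext (U : lmodType k) (g h : {linear tens V W -> U}) :
  (forall v w, g (v ⊗ w) = h (v ⊗ w)) -> g =1 h.
Proof.
move=> gh t; rewrite [t](matrix_sum_delta (t : 'M[k]_(_, _))).
rewrite (linear_sum g) (linear_sum h); apply: eq_bigr => i _.
rewrite (linear_sum g) (linear_sum h); apply: eq_bigr => j _.
by rewrite -tprod_basis (linearZ_LR g) (linearZ_LR h) gh.
Qed.

End TensorProduct.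

Section YangBaxter.
Variables (k : fieldType) (L : fdLieAlgType k).

Definition br12_13 (r : tens L L) : tens L (tens L L) :=
  tlift (fun a b => tlift (fun a' b' => lie a a' ⊗ b ⊗ b') r) r.

Definition br12_23 (r : tens L L) : tens L (tens L L) :=
  tlift (fun a b => tlift (fun a' b' => a ⊗ lie b a' ⊗ b') r) r.

Definition br13_23 (r : tens L L) : tens L (tens L L) :=
  tlift (fun a b => tlift (fun a' b' => a ⊗ a' ⊗ lie b b') r) r.

Definition CYBE (r : tens L L) : Prop :=
  br12_13 r + br12_23 r + br13_23 r = 0.

(* The three brackets are given by the usual formulas on every decomposition of
   r into pure tensors. *)
Section Decomposition.
Variables (I : finType) (a b : I -> L).
Let r : tens L L := \sum_i a i ⊗ b i.

Lemma tlift_sum2 (U : lmodType k) (f : L -> L -> L -> L -> U) :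
  (forall x y z, linear (fun t => f t x y z)) ->
  (forall x y z, linear (fun t => f x t y z)) ->
  (forall x y z, linear (fun t => f x y t z)) ->
  (forall x y z, linear (fun t => f x y z t)) ->
  tlift (fun x y => tlift (f x y) r) r
    = \sum_i \sum_j f (a i) (b i) (a j) (b j).
Proof.
move=> f1 f2 f3 f4.
have lift_sum (g : L -> L -> U) : (forall y, linear (g^~ y)) ->
    (forall x, linear (g x)) -> tlift g r = \sum_i g (a i) (b i).
  move=> gl gr.
  pose m := GRing.isLinear.Build k _ U _ (tlift g) (tlift_linear g).
  pose G : {linear tens L L -> U} := HB.pack (tlift g) m.
  rewrite -[LHS]/(G r) linear_sum; apply: eq_bigr => i _.
  exact: tlift_tprod.
have E x y : tlift (f x y) r = \sum_j f x y (a j) (b j) by apply: lift_sum.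
rewrite lift_sum => [|y c u v|x c u v].
- by apply: eq_bigr => i _; rewrite E.
- by rewrite !E scaler_sumr -big_split; apply: eq_bigr => j _; apply: f1.
- by rewrite !E scaler_sumr -big_split; apply: eq_bigr => j _; apply: f2.
Qed.

Let tl := tprod_linearl.
Let tr := tprod_linearr.

Lemma br12_13_sum :
  br12_13 r = \sum_i \sum_j lie (a i) (a j) ⊗ b i ⊗ b j.
Proof.
apply: (tlift_sum2 (f := fun x y z t => lie x z ⊗ y ⊗ t)) => x y z c u v.
- by rewrite lie_linearl tl.
- by rewrite tl tr.
- by rewrite lie_linearr tl.
- by rewrite !tr.
Qed.

Lemma br12_23_sum :
  br12_23 r = \sum_i \sum_j a i ⊗ lie (b i) (a j) ⊗ b j.
Proof.
apply: (tlift_sum2 (f := fun x y z t => x ⊗ lie y z ⊗ t)) => x y z c u v.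
- by rewrite tl.
- by rewrite lie_linearl tl tr.
- by rewrite lie_linearr tl tr.
- by rewrite !tr.
Qed.

Lemma br13_23_sum :
  br13_23 r = \sum_i \sum_j a i ⊗ a j ⊗ lie (b i) (b j).
Proof.
apply: (tlift_sum2 (f := fun x y z t => x ⊗ z ⊗ lie y t)) => x y z c u v.
- by rewrite tl.
- by rewrite lie_linearl !tr.
- by rewrite tl tr.
- by rewrite lie_linearr !tr.
Qed.

End Decomposition.

Definition strongly_symmetric (e : 3.-tuple L) (r : tens L L) : Prop :=
  exists K : 'M[k]_3,
    [/\ r = \sum_i \sum_j K i j *: (tnth e i ⊗ tnth e j),
        forall i j, K i j = K j i
      & forall i j l m, K i j * K l m = K i l * K j m].

End YangBaxter.

(* Main.v *)
From HB Require Import structures.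
Require Import Defs.
From mathcomp Require Import all_boot all_order all_algebra.
From mathcomp Require Import ring.

Set Implicit Arguments.
Unset Strict Implicit.
Unset Printing Implicit Defensive.

Import GRing.Theory.
Local Open Scope ring_scope.

(** Write r as the sum of the K_ij e_i ⊗ e_j. Comparing coordinates in
    e_a ⊗ e_b ⊗ e_c, the Yang-Baxter equation says that for all a, b, c
<<
      [col_b, col_c]_a + [row_a, col_c]_b + [row_a, row_b]_c = 0,
>>
    where row_i and col_j are the vectors whose coordinates are the rows and the
    columns of K ([CYBE_coordP], valid in every finite-dimensional Lie algebra).

    If K is strongly symmetric then rows and columns agree and
    K_ib K_jc = K_bc K_ij, so each bracket above is a multiple of the sum of the
    K_ij [e_i, e_j], which vanishes because K is symmetric and the bracket is
    antisymmetric and 2 is invertible. This is (I), and it uses nothing about L.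

    In the three-dimensional algebra [x, y] = y_3 N x - x_3 N y, where N is the
    map [-, e_3] on the span of e_1 and e_2. The 27 coordinate equations are
    then explicit quadratic equations in the entries
<<
      x p s
      q y u
      t v z
>>
    of K. Those that do not involve beta and delta already give a dichotomy
    ([cybe_sys_cases]): either z <> 0, t = s and z x = s^2, or z = 0 and t = - s.

    Suppose delta <> 0. In the first case the other equations force every 2 x 2
    minor through the pivot z to vanish and K to be symmetric
    ([cybe_sys_pivot]), so that r is strongly symmetric. In the second one they
    force v = - u: the difference of the equations (3,2,2) and (2,2,3) is
    delta (v + u)^2 = 0. What remains is a short list of relations, equivalent
    to the whole system ([cybe_sys_degenerate], [degenerate_cybe_sys]). Parts
    (II) and (III) are the specializations beta = 0 and delta = 1 of this list;
    in (III) the relation (1 - delta) u s = beta s^2 kills s.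

    For beta = delta = 0 the same dichotomy gives the two families of (IV). *)

Lemma mul2r_eq0 (k : fieldType) (char_k : 2%N \notin [pchar k]) (a : k) :
  2%:R * a = 0 -> a = 0.
Proof.
have two_neq0 : 2%:R != 0 :> k.
  by apply: contra char_k => /eqP two0; rewrite inE /= two0 eqxx.
by move/eqP; rewrite mulf_eq0 (negPf two_neq0) => /eqP.
Qed.

(** Nested, [lincomb c1 E1 (lincomb c2 E2 ...)] proves that a linear combination
    of left-hand sides of equations vanishes; with [etrans], it reduces a goal
    P = 0 to a polynomial identity. *)
Lemma lincomb (k : fieldType) (c a b : k) : a = 0 -> b = 0 -> c * a + b = 0.
Proof. by move=> -> ->; rewrite mulr0 addr0. Qed.

(** * Coordinates in a tensor product *)

HB.instance Definition _ (k : fieldType) (V W : vectType k) (v : V) :=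
  GRing.isLinear.Build k W (tens V W) _ (tprod v) (tprod_linearr v).

HB.instance Definition _ (k : fieldType) (L : fdLieAlgType k) (x : L) :=
  GRing.isLinear.Build k L L _ (lie x) (lie_linearr x).

Section Contraction.
Variables (k : fieldType) (V W : vectType k) (n : nat) (e : n.-tuple V).

(** Evaluation of the first factor at the i-th linear form of the dual basis. *)
Definition contract (i : 'I_n) : tens V W -> W :=
  tlift (fun v w => coord e i v *: w).

HB.instance Definition _ i :=
  GRing.isLinear.Build k (tens V W) W _ (contract i) (tlift_linear _).

Lemma contract_tprod i v w : contract i (v ⊗ w) = coord e i v *: w.
Proof.
apply: (tlift_tprod (f := fun v w => coord e i v *: w)) => [y c u u'|x c u u'].
  by rewrite linearP /= scalerDl scalerA.
by rewrite scalerDr !scalerA mulrC.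
Qed.

Hypothesis basis_e : basis_of {:V} e.

(** Both sides are linear in t, so it suffices to compare them on pure tensors. *)
Lemma tens_contract (t : tens V W) : t = \sum_i tnth e i ⊗ contract i t.
Proof.
have linS : linear (fun s : tens V W => \sum_i tnth e i ⊗ contract i s).
  move=> c u v; rewrite scaler_sumr -big_split; apply: eq_bigr => i _.
  by rewrite !linearP.
pose S : {linear tens V W -> tens V W} := HB.pack
  (fun s : tens V W => \sum_i tnth e i ⊗ contract i s)
  (GRing.isLinear.Build k _ _ _ _ linS).
apply: (@tens_linear_ext _ _ _ _ idfun S) => v w /=.
pose Tl : {linear V -> tens V W} := HB.pack (fun v => v ⊗ w)
  (GRing.isLinear.Build k V _ _ (fun v => v ⊗ w) (tprod_linearl w)).
rewrite -[LHS]/(Tl v) [v in LHS](coord_basis basis_e (memvf v)) linear_sum.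
by apply: eq_bigr => i _; rewrite contract_tprod !linearZ /= (tnth_nth 0).
Qed.

Lemma contract_eq0 (t : tens V W) : t = 0 <-> forall i, contract i t = 0.
Proof.
split=> [-> i|t0]; first exact: linear0.
by rewrite [t]tens_contract big1 // => i _; rewrite t0 linear0.
Qed.

End Contraction.

(** * The Yang-Baxter equation in coordinates *)

Section Lie.
Variables (k : fieldType) (L : fdLieAlgType k) (n : nat) (e : n.-tuple L).

Lemma lie_suml (I : finType) (c : I -> k) (x : I -> L) y :
  lie (\sum_i c i *: x i) y = \sum_i c i *: lie (x i) y.
Proof.
pose Ll : {linear L -> L} := HB.pack (fun x : L => lie x y)
  (GRing.isLinear.Build k L L _ (fun x : L => lie x y) (lie_linearl y)).
rewrite -[LHS]/(Ll _) linear_sum; apply: eq_bigr => i _.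
by rewrite linearZ.
Qed.

Lemma lie_sumr (I : finType) (c : I -> k) (x : I -> L) y :
  lie y (\sum_i c i *: x i) = \sum_i c i *: lie y (x i).
Proof. by rewrite linear_sum; apply: eq_bigr => i _; rewrite linearZ. Qed.

Lemma lieC (x y : L) : lie x y = - lie y x.
Proof.
have lieDl (u v w : L) : lie (u + v) w = lie u w + lie v w.
  by have := lie_linearl w 1 u v; rewrite /= !scale1r.
apply/eqP; rewrite -addr_eq0; apply/eqP.
have := lie_alternating (x + y).
by rewrite lieDl !linearD /= !lie_alternating add0r addr0.
Qed.

Hypothesis basis_e : basis_of {:L} e.

Lemma coord_sum_basis (x : 'I_n -> k) i :
  coord e i (\sum_j x j *: tnth e j) = x i.
Proof.
rewrite (eq_bigr (fun j => x j *: e`_j)) => [|j _]; last by rewrite (tnth_nth 0).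
exact: coord_sum_free (basis_free basis_e).
Qed.

Lemma coord_tnth i j : coord e i (tnth e j) = (i == j)%:R.
Proof. by rewrite (tnth_nth 0) coord_free ?(basis_free basis_e) // eq_sym. Qed.

Lemma coord_eq0 (x : L) : x = 0 <-> forall i, coord e i x = 0.
Proof.
split=> [-> i|x0]; first exact: linear0.
by rewrite (coord_basis basis_e (memvf x)) big1 // => i _; rewrite x0 scale0r.
Qed.

Definition tcoord3 a b c (t : tens L (tens L L)) : k :=
  coord e c (contract e b (contract e a t)).

Lemma tcoord3_linear a b c : scalar (tcoord3 a b c).
Proof. by move=> s u v; rewrite /tcoord3 !linearP. Qed.

HB.instance Definition _ a b c :=
  GRing.isLinear.Build k (tens L (tens L L)) k *%R (tcoord3 a b c)
    (tcoord3_linear a b c).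

Lemma tcoord3_tprod a b c x y z :
  tcoord3 a b c (x ⊗ y ⊗ z) = coord e a x * coord e b y * coord e c z.
Proof.
rewrite /tcoord3 contract_tprod linearZ /= contract_tprod !linearZ /=.
by rewrite mulrA.
Qed.

Lemma tcoord3_eq0 t : t = 0 <-> forall a b c, tcoord3 a b c t = 0.
Proof.
split=> [-> a b c|t0]; first exact: linear0.
apply/(contract_eq0 basis_e) => a; apply/(contract_eq0 basis_e) => b.
by apply/coord_eq0 => c; apply: t0.
Qed.

Variable K : 'M[k]_n.
Let r : tens L L := \sum_i \sum_j K i j *: (tnth e i ⊗ tnth e j).
Definition row_vect i := \sum_j K i j *: tnth e j.
Definition col_vect j := \sum_i K i j *: tnth e i.

(** This decomposition has basis vectors as left factors, which makes the sums
    for the three brackets collapse in coordinates. *)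
Lemma sum_row_vect : r = \sum_i tnth e i ⊗ row_vect i.
Proof.
apply: eq_bigr => i _; rewrite linear_sum; apply: eq_bigr => j _.
by rewrite linearZ.
Qed.

Lemma tcoord3_br12_13 a b c :
  tcoord3 a b c (br12_13 r) = coord e a (lie (col_vect b) (col_vect c)).
Proof.
rewrite sum_row_vect br12_13_sum lie_suml !linear_sum; apply: eq_bigr => i _.
rewrite lie_sumr scaler_sumr !linear_sum; apply: eq_bigr => j _.
by rewrite /= tcoord3_tprod !coord_sum_basis !linearZ /= -mulrA mulrC -mulrA.
Qed.

Lemma tcoord3_br12_23 a b c :
  tcoord3 a b c (br12_23 r) = coord e b (lie (row_vect a) (col_vect c)).
Proof.
rewrite sum_row_vect br12_23_sum linear_sum (bigD1 a) //= [X in _ + X]big1.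
  rewrite addr0 lie_sumr !linear_sum; apply: eq_bigr => j _.
  rewrite /= tcoord3_tprod coord_tnth eqxx coord_sum_basis !linearZ.
  by rewrite mul1r mulrC.
move=> i ia; rewrite linear_sum big1 // => j _.
by rewrite /= tcoord3_tprod coord_tnth eq_sym (negPf ia) !mul0r.
Qed.

Lemma tcoord3_br13_23 a b c :
  tcoord3 a b c (br13_23 r) = coord e c (lie (row_vect a) (row_vect b)).
Proof.
rewrite sum_row_vect br13_23_sum linear_sum (bigD1 a) //= [X in _ + X]big1.
  rewrite addr0 linear_sum (bigD1 b) //= big1.
    by rewrite /= tcoord3_tprod !coord_tnth !eqxx addr0 !mul1r.
  move=> j jb; rewrite tcoord3_tprod !coord_tnth eqxx eq_sym (negPf jb).
  by rewrite mulr0 mul0r.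
move=> i ia; rewrite linear_sum big1 // => j _.
by rewrite /= tcoord3_tprod coord_tnth eq_sym (negPf ia) !mul0r.
Qed.

(** The brackets at positions 12-13, 12-23 and 13-23 contribute the brackets
    column-column, row-column and row-row: the coefficients of r at a fixed
    index of its second, resp. first, tensor factor form a column, resp. a row. *)
Lemma CYBE_coordP :
  CYBE r <-> forall a b c, coord e a (lie (col_vect b) (col_vect c))
    + coord e b (lie (row_vect a) (col_vect c))
    + coord e c (lie (row_vect a) (row_vect b)) = 0.
Proof.
rewrite /CYBE tcoord3_eq0; split=> H a b c; move: (H a b c);
  by rewrite !linearD /= tcoord3_br12_13 tcoord3_br12_23 tcoord3_br13_23.
Qed.

Lemma strongly_symmetric_col_row (Ksym : forall i j, K i j = K j i) i :
  col_vect i = row_vect i.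
Proof. by apply: eq_bigr => j _; rewrite Ksym. Qed.

(** Exchanging the inner indices in K_ib K_jc = K_ij K_bc leaves a multiple of
    the sum of the K_ij [e_i, e_j], which is its own opposite. *)
Lemma lie_col_vect_eq0 (char_k : 2%N \notin [pchar k])
    (Ksym : forall i j, K i j = K j i)
    (Kmul : forall i j l m, K i j * K l m = K i l * K j m) b c :
  lie (col_vect b) (col_vect c) = 0.
Proof.
have -> : lie (col_vect b) (col_vect c)
    = K b c *: \sum_i \sum_j K i j *: lie (tnth e i) (tnth e j).
  rewrite lie_suml scaler_sumr; apply: eq_bigr => i _.
  rewrite lie_sumr !scaler_sumr; apply: eq_bigr => j _.
  by rewrite !scalerA Kmul mulrC.
set S := \sum_i _; suff -> : S = 0 by rewrite scaler0.
have SN : S = - S.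
  rewrite {1}/S exchange_big -sumrN; apply: eq_bigr => i _.
  rewrite -sumrN; apply: eq_bigr => j _.
  by rewrite Ksym lieC scalerN.
apply/coord_eq0 => i; apply: (mul2r_eq0 char_k).
by rewrite mulr_natl mulr2n -linearD {1}SN addNr linear0.
Qed.

End Lie.

(** * The three-dimensional algebra *)

Local Notation i1 := (@Ordinal 3 0 isT).
Local Notation i2 := (@Ordinal 3 1 isT).
Local Notation i3 := (@Ordinal 3 2 isT).

Lemma sum3 (V : nmodType) (F : 'I_3 -> V) : \sum_i F i = F i1 + F i2 + F i3.
Proof.
rewrite !big_ord_recl big_ord0 addr0 addrA.
by congr (F _ + F _ + F _); apply: val_inj.
Qed.

Lemma forall3 (P : 'I_3 -> Prop) : P i1 -> P i2 -> P i3 -> forall i, P i.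
Proof.
move=> P1 P2 P3 [[|[|[|//]]] lt_i].
- by rewrite (val_inj (erefl : val (Ordinal lt_i) = val i1)).
- by rewrite (val_inj (erefl : val (Ordinal lt_i) = val i2)).
- by rewrite (val_inj (erefl : val (Ordinal lt_i) = val i3)).
Qed.

Section Algebra3.
Variables (k : fieldType) (beta delta : k).

(** The coordinates of [x, y]. The third one is the default value 0, the derived
    algebra being contained in the span of e_1 and e_2. *)
Definition lie_coef (x y : 'I_3 -> k) (m : 'I_3) : k :=
  nth 0 [:: x i1 * y i3 - x i3 * y i1;
    beta * (x i1 * y i3 - x i3 * y i1)
      + delta * (x i2 * y i3 - x i3 * y i2)] m.

Definition cybe_coef (K : 'M[k]_3) (a b c : 'I_3) : k :=
  lie_coef (K^~ b) (K^~ c) a + lie_coef (K a) (K^~ c) b + lie_coef (K a) (K b) c.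

Definition mx3 x p s q y u t v z : 'M[k]_3 :=
  \matrix_(i, j)
    nth 0 (nth [::] [:: [:: x; p; s]; [:: q; y; u]; [:: t; v; z]] i) j.

Lemma mx3_eta (K : 'M[k]_3) :
  K = mx3 (K i1 i1) (K i1 i2) (K i1 i3) (K i2 i1) (K i2 i2) (K i2 i3)
          (K i3 i1) (K i3 i2) (K i3 i3).
Proof. by apply/matrixP; do 2!(apply: forall3); rewrite mxE. Qed.

Variables (L : fdLieAlgType k) (e1 e2 e3 : L).
Hypotheses (basis_e : basis_of {:L} [:: e1; e2; e3])
    (lie12 : lie e1 e2 = 0)
    (lie13 : lie e1 e3 = e1 + beta *: e2)
    (lie23 : lie e2 e3 = delta *: e2).
Let e := [tuple e1; e2; e3].

Lemma lie3 (x y : 'I_3 -> k) :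
  lie (\sum_i x i *: tnth e i) (\sum_j y j *: tnth e j)
    = \sum_m lie_coef x y m *: tnth e m.
Proof.
rewrite lie_suml sum3 !lie_sumr !sum3 /= !(tnth_nth 0) /=.
rewrite (lieC e2 e1) (lieC e3 e1) (lieC e3 e2) lie12 lie13 lie23.
rewrite !lie_alternating /lie_coef /= oppr0 !scaler0 !addr0 !add0r.
rewrite !(scalerDr, scalerN, scalerA, opprD) -!scaleNr.
rewrite addrACA [X in X + _]addrACA -addrA.
by rewrite -!scalerDl scale0r addr0; congr (_ *: _ + _ *: _); ring.
Qed.

Definition tens3 x p s q y u t v z : tens L L :=
   x *: (e1 ⊗ e1) + p *: (e1 ⊗ e2) + s *: (e1 ⊗ e3)
 + (q *: (e2 ⊗ e1) + y *: (e2 ⊗ e2) + u *: (e2 ⊗ e3))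
 + (t *: (e3 ⊗ e1) + v *: (e3 ⊗ e2) + z *: (e3 ⊗ e3)).

Lemma sum_mx3 x p s q y u t v z :
  \sum_i \sum_j mx3 x p s q y u t v z i j *: (tnth e i ⊗ tnth e j)
    = tens3 x p s q y u t v z.
Proof. by rewrite sum3 !sum3 !mxE. Qed.

Lemma tens3_ex (r : tens L L) :
  exists x p s q y u t v z, r = tens3 x p s q y u t v z.
Proof.
pose K := \matrix_(i, j) coord e j (contract e i r) : 'M[k]_3.
have -> : r = \sum_i \sum_j K i j *: (tnth e i ⊗ tnth e j).
  rewrite [LHS](tens_contract (basis_e : basis_of _ e)); apply: eq_bigr => i _.
  rewrite {1}[contract e i r](coord_basis (basis_e : basis_of _ e) (memvf _)).
  rewrite linear_sum; apply: eq_bigr => j _.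
  by rewrite linearZ mxE (tnth_nth 0 e j).
by rewrite [K]mx3_eta sum_mx3; do 9!eexists.
Qed.

Lemma CYBE3P x p s q y u t v z :
  CYBE (tens3 x p s q y u t v z) <->
    forall a b c, cybe_coef (mx3 x p s q y u t v z) a b c = 0.
Proof.
rewrite -sum_mx3 (CYBE_coordP (basis_e : basis_of _ e)) /row_vect /col_vect.
split=> H a b c; move: (H a b c);
  by rewrite !lie3 !(coord_sum_basis (basis_e : basis_of _ e)).
Qed.

Lemma strongly_symmetric_CYBE (char_k : 2%N \notin [pchar k]) (r : tens L L) :
  strongly_symmetric e r -> CYBE r.
Proof.
case=> K [-> Ksym Kmul]; apply/(CYBE_coordP (basis_e : basis_of _ e)) => a b c.
by rewrite -!strongly_symmetric_col_row // !lie_col_vect_eq0 // !linear0 !addr0.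
Qed.

End Algebra3.

(** The relations say that the (i, j) entry is w_i w_j / z for w = (s, u, z). *)
Lemma strongly_symmetric_pivot (k : fieldType) (L : fdLieAlgType k)
    (e1 e2 e3 : L) x p s q y u z :
  z != 0 -> z * x = s ^+ 2 -> z * p = s * u -> z * q = s * u ->
  z * y = u ^+ 2 ->
  strongly_symmetric [tuple e1; e2; e3] (tens3 e1 e2 e3 x p s q y u s u z).
Proof.
move=> z0 zx zp zq zy.
exists (mx3 x p s q y u s u z); rewrite sum_mx3.
have divz a b : z * a = b -> a = b / z by move=> <-; rewrite mulrC mulKf.
rewrite (divz _ _ zx) (divz _ _ zp) (divz _ _ zq) (divz _ _ zy).
by split=> //; do ![apply: forall3]; rewrite !mxE //=; field.
Qed.

(** * Solving the system of coordinate equations *)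

Definition cybe_sys (k : fieldType) (beta delta x p s q y u t v z : k) :=
  forall a b c, cybe_coef beta delta (mx3 x p s q y u t v z) a b c = 0.

(** The entries (x, p, s), (q, y, u), (- s, - u, 0) of the solutions with z = 0
    when delta <> 0. *)
Definition degenerate (k : fieldType) (beta delta x p s q y u : k) :=
  [/\ x * s = 0, x * u = 0 & (1 - delta) * u * s - beta * s ^+ 2 = 0]
  /\ [/\ (1 + delta) * s * (q + p) = 0, (1 + delta) * u * (q + p) = 0,
    beta * s * (q + p) + 2%:R * (delta * s * y) = 0
    & beta * u * (q + p) + 2%:R * (delta * u * y) = 0].

Section Necessity.
Variables (k : fieldType) (char_k : 2%N \notin [pchar k]) (beta delta : k).
Variables x p s q y u t v z : k.
Hypothesis sys : cybe_sys beta delta x p s q y u t v z.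

Local Tactic Notation "coef" constr(a) constr(b) constr(c) :=
  have := sys a b c; rewrite /cybe_coef /lie_coef !mxE /=.

(** Coefficients (3,1,1) and (1,1,3) give t (t + s) = 2 z x = s (s + t). For
    z <> 0, coefficient (3,1,3), which is z (t - s), gives t = s, and then
    2 z x = 2 s^2; for z = 0 the sum of the two equations is (t + s)^2 = 0. *)
Lemma cybe_sys_cases :
  [/\ z != 0, t = s & z * x = s ^+ 2]
  \/ [/\ z = 0, t = - s, x * s = 0, x * u = 0 & x * v = 0].
Proof.
have eq113 : 2%:R * (z * x) - s * (s + t) = 0 by coef i1 i1 i3 => <-; ring.
have [z0|z_neq0] := eqVneq z 0; last first.
  left; have /eqP : z * (t - s) = 0 by coef i3 i1 i3 => <-; ring.
  rewrite mulf_eq0 (negPf z_neq0) subr_eq0 => /eqP ts.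
  split=> //; apply: subr0_eq; apply: (mul2r_eq0 char_k).
  by rewrite -eq113 ts; ring.
right; have ts : t = - s.
  have eq311 : t ^+ 2 + s * t - 2%:R * (z * x) = 0.
    by coef i3 i1 i1 => <-; ring.
  apply/eqP; rewrite -addr_eq0 -sqrf_eq0; apply/eqP.
  apply: etrans (lincomb 1 eq311 (lincomb (- 1) eq113 (erefl 0))).
  by rewrite z0; ring.
split=> //; apply: (mul2r_eq0 char_k).
- coef i1 i1 i1 => E; apply: etrans (lincomb (- 1) E (erefl 0)).
  by rewrite ts; ring.
- coef i2 i1 i1 => E; apply: etrans (lincomb (- 1) E (erefl 0)).
  by rewrite ts; ring.
- by coef i1 i1 i2 => <-; rewrite ts; ring.
Qed.

Hypothesis delta_neq0 : delta != 0.

Lemma cybe_sys_pivot : z != 0 -> t = s -> z * x = s ^+ 2 ->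
  [/\ v = u, z * p = s * u, z * q = s * u & z * y = u ^+ 2].
Proof.
move=> z0 ts zx.
have vu : v = u.
  have : (z * delta) * (v - u) = 0 by coef i3 i2 i3 => <-; rewrite ts; ring.
  by move/eqP; rewrite !mulf_eq0 (negPf z0) (negPf delta_neq0) subr_eq0 => /eqP.
have zp : s * u - z * p = 0.
  (* Coefficients (1,3,2) and (3,1,2) are 1 - delta and 1 + delta times this. *)
  apply: (mul2r_eq0 char_k); coef i1 i3 i2 => E132; coef i3 i1 i2 => E312.
  apply: etrans (lincomb 1 E132 (lincomb 1 E312 (erefl 0))).
  by rewrite ts vu; ring: zx.
have zq : s * u - z * q = 0.
  apply: (mul2r_eq0 char_k); coef i2 i3 i1 => E231; coef i3 i2 i1 => E321.
  apply: etrans (lincomb 1 E321 (lincomb (- 1) E231 (erefl 0))).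
  by rewrite ts vu; ring: zx.
split=> //; [exact/esym/subr0_eq|exact/esym/subr0_eq|].
apply/esym/subr0_eq; apply: (mulfI delta_neq0); rewrite mulr0.
apply: (mul2r_eq0 char_k); coef i3 i2 i2 => <-.
by rewrite ts vu zp zq; ring.
Qed.

Lemma cybe_sys_degenerate : z = 0 -> t = - s -> x * s = 0 -> x * u = 0 ->
  v = - u /\ degenerate beta delta x p s q y u.
Proof.
move=> z0 ts xs xu.
have vu : v = - u.
  have : delta * (v + u) ^+ 2 = 0.
    coef i3 i2 i2 => E322; coef i2 i2 i3 => E223.
    apply: etrans (lincomb 1 E322 (lincomb (- 1) E223 (erefl 0))).
    by rewrite ts z0; ring.
  by move/eqP; rewrite mulf_eq0 sqrf_eq0 (negPf delta_neq0) addr_eq0 => /eqP.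
have E122 := sys i1 i2 i2; rewrite /cybe_coef /lie_coef !mxE /= in E122.
have sy : beta * s * (q + p) + 2%:R * (delta * s * y) = 0.
  by apply: etrans (lincomb (- 1) E122 (erefl 0)); rewrite vu; ring.
split=> //; split; split=> //.
- coef i3 i1 i2 => E; apply: etrans (lincomb 1 E (erefl 0)).
  by rewrite vu ts z0; ring.
- coef i1 i2 i1 => E.
  apply: etrans (lincomb (- 1) E
    (lincomb 2%:R xu (lincomb (- 2%:R * beta) xs (erefl 0)))).
  by rewrite vu ts; ring.
- coef i2 i1 i2 => E.
  apply: etrans (lincomb (- 1) E
    (lincomb (- 2%:R * beta) xu (lincomb 1 sy (erefl 0)))).
  by rewrite vu ts; ring.
- coef i2 i2 i2 => E; apply: etrans (lincomb (- 1) E (erefl 0)).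
  by rewrite vu; ring.
Qed.

End Necessity.

Section Sufficiency.
Variables (k : fieldType) (beta delta x p s q y u v z : k).

Lemma degenerate_cybe_sys :
  degenerate beta delta x p s q y u ->
  cybe_sys beta delta x p s q y u (- s) (- u) 0.
Proof.
case=> [[xs xu us] [sp up sy uy]]; pose nil : 0 = 0 :> k := erefl.
(* Each of the 27 coefficients is one of the combinations listed. *)
rewrite /cybe_sys; do 3!apply: forall3; rewrite /cybe_coef /lie_coef !mxE /=;
  first [ by ring
        | by apply: etrans (lincomb (- 2%:R) xs nil); ring
        | by apply: etrans (lincomb (- 2%:R) xu nil); ring
        | by apply: etrans (lincomb 1 us nil); ring
        | by apply: etrans (lincomb (- 1) us nil); ring
        | by apply: etrans (lincomb (- 1) sp (lincomb 2%:R xu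
            (lincomb (- 2%:R * beta) xs nil))); ring
        | by apply: etrans (lincomb 1 sy (lincomb (- 1) up
            (lincomb (- 2%:R * beta) xu nil))); ring
        | by apply: etrans (lincomb (- 1) sy nil); ring
        | by apply: etrans (lincomb (- 1) uy nil); ring ].
Qed.

(** Apart from y, the entries are those of the product of the column (s, u, z)
    and the row (s, v, z) / z, and y does not enter the equations because e_2 is
    central when beta = delta = 0. *)
Lemma cybe_sys_pivot_delta0 :
  z != 0 -> z * p = v * s -> z * q = u * s -> z * x = s ^+ 2 ->
  cybe_sys 0 0 x p s q y u s v z.
Proof.
move=> z0 zp zq zx.
have divz a b : z * a = b -> a = b / z by move=> <-; rewrite mulrC mulKf.
rewrite (divz _ _ zx) (divz _ _ zp) (divz _ _ zq) /cybe_sys.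
by do 3!apply: forall3; rewrite /cybe_coef /lie_coef !mxE /=; field.
Qed.

Lemma cybe_sys_degenerate_delta0 :
  u * s = 0 -> v * s = 0 -> x * s = 0 -> x * u = 0 -> x * v = 0 ->
  u * p = q * v -> s * (p + q) = 0 ->
  cybe_sys 0 0 x p s q y u (- s) v 0.
Proof.
move=> us vs xs xu xv up sp.
pose nil : 0 = 0 :> k := erefl; move/eqP: up; rewrite -subr_eq0 => /eqP up.
(* Each of the 27 coefficients is one of the combinations listed. *)
rewrite /cybe_sys; do 3!apply: forall3; rewrite /cybe_coef /lie_coef !mxE /=;
  first [ by ring
        | by apply: etrans (lincomb (- 2%:R) xs nil); ring
        | by apply: etrans (lincomb (- 2%:R) xu nil); ring
        | by apply: etrans (lincomb 2%:R xv nil); ring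
        | by apply: etrans (lincomb 1 us nil); ring
        | by apply: etrans (lincomb (- 1) us nil); ring
        | by apply: etrans (lincomb 1 vs nil); ring
        | by apply: etrans (lincomb (- 1) vs nil); ring
        | by apply: etrans (lincomb (- 1) sp (lincomb (- 1) xv
            (lincomb 1 xu nil))); ring
        | by apply: etrans (lincomb (- 1) up nil); ring ].
Qed.

End Sufficiency.

(** * The classification *)

Lemma CYBE_delta_neq0 (k : fieldType) (char_k : 2%N \notin [pchar k])
    (beta delta : k) (L : fdLieAlgType k) (e1 e2 e3 : L)
    (basis_e : basis_of {:L} [:: e1; e2; e3])
    (lie12 : lie e1 e2 = 0)
    (lie13 : lie e1 e3 = e1 + beta *: e2)
    (lie23 : lie e2 e3 = delta *: e2)
    (r : tens L L) : delta != 0 ->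
  CYBE r <->
    strongly_symmetric [tuple e1; e2; e3] r \/
    exists p q s u x y : k, degenerate beta delta x p s q y u
      /\ r = tens3 e1 e2 e3 x p s q y u (- s) (- u) 0.
Proof.
have CYBE3 := CYBE3P basis_e lie12 lie13 lie23 => d0; split.
  have [x [p [s [q [y [u [t [v [z ->]]]]]]]]] := tens3_ex basis_e r.
  move=> /CYBE3 sys.
  have [[z_neq0 ts zx]|[z0 ts xs xu _]] := cybe_sys_cases char_k sys.
    have [vu zp zq zy] := cybe_sys_pivot char_k sys d0 z_neq0 ts zx.
    by left; rewrite ts vu; apply: strongly_symmetric_pivot.
  right; have [vu deg] := cybe_sys_degenerate sys d0 z0 ts xs xu.
  by exists p, q, s, u, x, y; rewrite z0 ts vu.
case=> [/(strongly_symmetric_CYBE basis_e char_k) //|].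
by move=> [p [q [s [u [x [y [deg ->]]]]]]]; apply/CYBE3/degenerate_cybe_sys.
Qed.

Theorem proposition1p6 (k : fieldType) (char_k : 2%N \notin [pchar k])
    (beta delta : k) (L : fdLieAlgType k) (e1 e2 e3 : L)
    (basis_e : basis_of {:L} [:: e1; e2; e3])
    (lie12 : lie e1 e2 = 0)
    (lie13 : lie e1 e3 = e1 + beta *: e2)
    (lie23 : lie e2 e3 = delta *: e2)
    (r : tens L L) :
  (* (I) *)
  (strongly_symmetric [tuple e1; e2; e3] r -> CYBE r)
  /\
  (* (II) *)
  (beta = 0 -> delta <> 0 ->
   (CYBE r <->
    strongly_symmetric [tuple e1; e2; e3] r \/
    exists p q s u x y : k,
      (x * u = 0 /\ x * s = 0 /\ y * s = 0 /\ y * u = 0 /\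
       (1 - delta) * u * s = 0 /\ (1 + delta) * s * (q + p) = 0 /\
       (1 + delta) * u * (q + p) = 0) /\
      r = p *: (e1 ⊗ e2) + q *: (e2 ⊗ e1)
          + s *: (e1 ⊗ e3) - s *: (e3 ⊗ e1)
          + u *: (e2 ⊗ e3) - u *: (e3 ⊗ e2)
          + x *: (e1 ⊗ e1) + y *: (e2 ⊗ e2)))
  /\
  (* (III) *)
  (beta <> 0 -> delta = 1 ->
   (CYBE r <->
    strongly_symmetric [tuple e1; e2; e3] r \/
    exists p q u x y : k,
      (x * u = 0 /\ y * u = 0 /\ u * (q + p) = 0) /\
      r = p *: (e1 ⊗ e2) + q *: (e2 ⊗ e1)
          + u *: (e2 ⊗ e3) - u *: (e3 ⊗ e2)
          + x *: (e1 ⊗ e1) + y *: (e2 ⊗ e2)))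
  /\
  (* (IV) *)
  (beta = 0 -> delta = 0 ->
   (CYBE r <->
    (exists p q s u v x y z : k,
       (z <> 0 /\ z * p = v * s /\ z * q = u * s /\ z * x = s ^+ 2) /\
       r = p *: (e1 ⊗ e2) + q *: (e2 ⊗ e1)
           + s *: (e1 ⊗ e3) + s *: (e3 ⊗ e1)
           + u *: (e2 ⊗ e3) + v *: (e3 ⊗ e2)
           + x *: (e1 ⊗ e1) + y *: (e2 ⊗ e2) + z *: (e3 ⊗ e3))
    \/
    (exists p q s u v x y : k,
       (u * s = 0 /\ v * s = 0 /\ x * s = 0 /\ x * u = 0 /\ x * v = 0 /\
        u * p = q * v /\ s * (p + q) = 0) /\
       r = p *: (e1 ⊗ e2) + q *: (e2 ⊗ e1)
           + s *: (e1 ⊗ e3) - s *: (e3 ⊗ e1)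
           + u *: (e2 ⊗ e3) + v *: (e3 ⊗ e2)
           + x *: (e1 ⊗ e1) + y *: (e2 ⊗ e2)))).
Proof.
have CYBE_neq0 := CYBE_delta_neq0 char_k basis_e lie12 lie13 lie23 r.
have CYBE3 := CYBE3P basis_e lie12 lie13 lie23.
split; first exact: strongly_symmetric_CYBE.
split=> [b0 /eqP d0|].
  apply: (iff_trans (CYBE_neq0 d0)); split=> -[ss|]; [by left| |by left|].
    move=> [p [q [s [u [x [y [[[xs xu us] [sp up sy uy]] ->]]]]]]]; right.
    rewrite {}b0 in us sy uy.
    have cancel a :
        0 * a * (q + p) + 2%:R * (delta * a * y) = 0 -> y * a = 0.
      rewrite !mul0r add0r -mulrA => /(mul2r_eq0 char_k)/eqP.
      by rewrite mulf_eq0 (negPf d0) mulrC => /eqP.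
    exists p, q, s, u, x, y; split; last first.
      by apply/matrixP=> i j; rewrite !mxE; ring.
    do 2!split=> //; split; first exact: cancel.
    split; first exact: cancel.
    by split=> //; rewrite -us; ring.
  move=> [p [q [s [u [x [y [[xu [xs [ys [yu [us [sp up]]]]]] ->]]]]]]]; right.
  exists p, q, s, u, x, y; split; last first.
    by apply/matrixP=> i j; rewrite !mxE; ring.
  rewrite b0; split; split=> //.
  - by rewrite us; ring.
  - by apply: etrans (lincomb (2%:R * delta) ys (erefl 0)); ring.
  - by apply: etrans (lincomb (2%:R * delta) yu (erefl 0)); ring.
split=> [/eqP b0 d1|b0 d0].
  have d0 : delta != 0 by rewrite d1 oner_neq0.
  apply: (iff_trans (CYBE_neq0 d0)); split=> -[ss|]; [by left| |by left|].
    move=> [p [q [s [u [x [y [[[xs xu us] [sp up sy uy]] ->]]]]]]]; right.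
    rewrite {}d1 in us up uy.
    have s0 : s = 0.
      have /eqP : beta * s ^+ 2 = 0 by rewrite -[RHS]oppr0 -us; ring.
      by rewrite mulf_eq0 sqrf_eq0 (negPf b0) => /eqP.
    have upq : u * (q + p) = 0.
      by apply: (mul2r_eq0 char_k); rewrite -up; ring.
    have yu : y * u = 0.
      apply: (mul2r_eq0 char_k).
      by apply: etrans (lincomb 1 uy (lincomb (- beta) upq (erefl 0))); ring.
    exists p, q, u, x, y; split=> //.
    by rewrite s0; apply/matrixP=> i j; rewrite !mxE; ring.
  move=> [p [q [u [x [y [[xu [yu upq]] ->]]]]]]; right.
  exists p, q, 0, u, x, y; split; last first.
    by apply/matrixP=> i j; rewrite !mxE; ring.
  rewrite d1; split; split=> //; try ring.
  - by apply: etrans (lincomb (1 + 1) upq (erefl 0)); ring.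
  - by apply: etrans (lincomb beta upq (lincomb 2%:R yu (erefl 0))); ring.
split.
  have [x [p [s [q [y [u [t [v [z ->]]]]]]]]] := tens3_ex basis_e r.
  move=> /CYBE3 sys.
  have E312 := sys i3 i1 i2; rewrite /cybe_coef /lie_coef !mxE /= in E312.
  have E321 := sys i3 i2 i1; rewrite /cybe_coef /lie_coef !mxE /= in E321.
  have [[/eqP z_neq0 ts zx]|[z0 ts xs xu xv]] := cybe_sys_cases char_k sys.
    left; exists p, q, s, u, v, x, y, z; split; last first.
      by rewrite ts; apply/matrixP=> i j; rewrite !mxE; ring.
    split=> //; split; last split=> //.
      by apply/esym/subr0_eq; rewrite -E312 b0 d0 ts; ring.
    by apply/esym/subr0_eq; rewrite -E321 b0 d0 ts; ring.
  right; exists p, q, s, u, v, x, y; split; last first.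
    by rewrite ts z0; apply/matrixP=> i j; rewrite !mxE; ring.
  have E121 := sys i1 i2 i1; rewrite /cybe_coef /lie_coef !mxE /= in E121.
  have E212 := sys i2 i1 i2; rewrite /cybe_coef /lie_coef !mxE /= in E212.
  split.
    apply: etrans (lincomb (- 1) E321 (erefl 0)).
    by rewrite b0 d0 ts z0; ring.
  split.
    apply: etrans (lincomb (- 1) E312 (erefl 0)).
    by rewrite b0 d0 ts z0; ring.
  do 3!split=> //; split.
    apply: subr0_eq; apply: etrans (lincomb (- 1) E212 (erefl 0)).
    by rewrite b0 d0 ts; ring.
  apply: etrans (lincomb (- 1) E121
    (lincomb 1 xu (lincomb (- 1) xv (erefl 0)))).
  by rewrite b0 d0 ts; ring.
case=> [[p [q [s [u [v [x [y [z [[/eqP z0 [zp [zq zx]]] r1]]]]]]]]]|].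
  have /CYBE3 : cybe_sys beta delta x p s q y u s v z.
    by rewrite b0 d0; apply: cybe_sys_pivot_delta0.
  by rewrite r1; congr CYBE; apply/matrixP=> i j; rewrite !mxE; ring.
move=> [p [q [s [u [v [x [y [[us [vs [xs [xu [xv [up sp]]]]]] r1]]]]]]]].
have /CYBE3 : cybe_sys beta delta x p s q y u (- s) v 0.
  by rewrite b0 d0; apply: cybe_sys_degenerate_delta0.
by rewrite r1; congr CYBE; apply/matrixP=> i j; rewrite !mxE; ring.
Qed.
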